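(* Let $X$ be a real reflexive Banach space, let $A\colon X\to X^*$ be continuous, linear, monotone, and symmetric, such that $\operatorname{ran}A$ is closed, and let $F\colon X\times X^*\to\left]-\infty,+\infty\right]$. Then $F=\mathcal{C}_A$ if and only if all three of the following conditions hold: (1) $F$ is autoconjugate; (2) $F(0,0)=0$; (3) $F(x,Ay)=F(y,Ax)$ for all $(x,y)\in X\times X$.
   Context: $X^*$ is the continuous dual of $X$ and $\langle\cdot,\cdot\rangle$ the pairing; $X^{**}$ is identified with $X$. A linear operator $A\colon X\to X^*$ is monotone if $\langle x,Ax\rangle\ge0$ for all $x\in X$, and (when continuous) symmetric if $A^*=A$, where the adjoint $A^*$ is regarded as a map $X\to X^*$; $\operatorname{ran}A=A(X)$. Put $A_+=\tfrac12A+\tfrac12A^*$, $A_\circ=\tfrac12A-\tfrac12A^*$, and for a continuous linear $L\colon X\to X^*$ let $q_L(x)=\tfrac12\langle x,Lx\rangle$. The Fenchel conjugate of $f\colon X\to\left]-\infty,+\infty\right]$ is $f^*(x^* )=\sup_{x\in X}\langle x,x^*\rangle-f(x)$. The function $\mathcal{C}_A\colon X\times X^*\to\left]-\infty,+\infty\right]$ is $\mathcal{C}_A(x,x^* )=q_{A_+}(x)+q_{A_+}^*(x^*-A_\circ x)$ (so for symmetric $A$, $\mathcal{C}_A(x,x^* )=q_A(x)+q_A^*(x^* )$). For $F\colon X\times X^*\to\left]-\infty,+\infty\right]$, $F^*(x^*,x)=\sup_{(y,y^* )\in X\times X^*}\langle y,x^*\rangle+\langle x,y^*\rangle-F(y,y^*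 )$; $F$ is autoconjugate if $F^*(x^*,x)=F(x,x^* )$ for all $(x,x^* )\in X\times X^*$. *)

(* Defs.v *)
(* MathComp-Analysis *)
From HB Require Import structures.
From mathcomp Require Import all_boot all_order all_algebra.
From mathcomp Require Import boolp classical_sets functions reals ereal.
From mathcomp Require Import topology normedtype.

Set Implicit Arguments.
Unset Strict Implicit.
Unset Printing Implicit Defensive.

Import Order.TTheory GRing.Theory Num.Theory.
Import numFieldNormedType.Exports.

Local Open Scope classical_set_scope.
Local Open Scope ring_scope.

(* Continuous linear maps, normed by the operator norm. *)

Section ContinuousLinear.
Context {R : realType} (X Y : normedModType R).

Definition clinear_pred : {pred X -> Y} :=
  [pred f : X -> Y | `[< linear f /\ continuous f >]].

Record clinear := Clinear {
  clinear_fun :> X -> Y;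
  clinear_funP : clinear_fun \in clinear_pred }.

HB.instance Definition _ := [isSub for clinear_fun].
HB.instance Definition _ := gen_eqMixin clinear.
HB.instance Definition _ := gen_choiceMixin clinear.

Fact clinear_submod_closed : submod_closed clinear_pred.
Proof.
split.
  apply/asboolP; split=> [a u v|] /=; first by rewrite scaler0 addr0.
  by move=> x; exact: cvg_cst.
move=> a f g /asboolP[lf cf] /asboolP[lg cg]; apply/asboolP; split.
  move=> b u v; rewrite !fctE lf lg !scalerDr !scalerA (mulrC b) -!addrA.
  by congr (_ + _); rewrite addrCA.
by move=> x; apply: cvgD; [apply: cvgZl_tmp; exact: cf|exact: cg].
Qed.

HB.instance Definition _ := GRing.isSubmodClosed.Build _ _ clinear_pred
  clinear_submod_closed.
HB.instance Definition _ := [SubChoice_isSubLmodule of clinear by <:].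

Lemma clinear_linear (f : clinear) : linear f.
Proof. by have /asboolP[] := clinear_funP f. Qed.

Lemma clinear_continuous (f : clinear) : continuous f.
Proof. by have /asboolP[] := clinear_funP f. Qed.

HB.instance Definition _ (f : clinear) :=
  GRing.isLinear.Build R X Y *:%R f (clinear_linear f).

Lemma clinearP (f g : clinear) : f =1 g -> f = g.
Proof. by move=> fg; apply: val_inj; exact/funext. Qed.

Definition opnorm (f : clinear) : R :=
  sup [set `|f x| | x in [set x : X | `|x| <= 1]].

Lemma opnorm_has_sup (f : clinear) :
  has_sup [set `|f x| | x in [set x : X | `|x| <= 1]].
Proof.
split; first by exists `|f 0|; exists 0 => //=; rewrite normr0 ler01.
have /bounded_funP/(_ 1)[M fM] :=
  @continuous_linear_bounded _ _ _ 0 f (@clinear_continuous f 0).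
by exists M => _ [x x1 <-]; exact: fM.
Qed.

Lemma opnorm_ge0 (f : clinear) : 0 <= opnorm f.
Proof.
apply: le_trans (normr_ge0 (f 0)) _; apply: ub_le_sup.
  by have [] := opnorm_has_sup f.
by exists 0 => //=; rewrite normr0 ler01.
Qed.

Lemma le_opnorm (f : clinear) x : `|f x| <= opnorm f * `|x|.
Proof.
have [->|x0] := eqVneq x 0; first by rewrite linear0 !normr0 mulr0.
have nx : 0 < `|x| by rewrite normr_gt0.
rewrite -ler_pdivrMr//.
have -> : `|f x| / `|x| = `|f (`|x|^-1 *: x)|.
  by rewrite linearZ/= normrZ normfV normr_id mulrC.
apply: ub_le_sup; first by have [] := opnorm_has_sup f.
by exists (`|x|^-1 *: x) => //=; rewrite normrZ normfV normr_id mulVf ?gt_eqF.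
Qed.

Lemma opnorm_le (f : clinear) M : 0 <= M ->
  (forall x, `|f x| <= M * `|x|) -> opnorm f <= M.
Proof.
move=> M0 fM; apply: ge_sup; first by have [] := opnorm_has_sup f.
move=> _ [x /= x1 <-]; apply: le_trans (fM x) _.
by rewrite -[leRHS]mulr1 ler_wpM2l.
Qed.

Fact opnormD f g : opnorm (f + g) <= opnorm f + opnorm g.
Proof.
apply: opnorm_le => [|x]; first by rewrite addr_ge0 ?opnorm_ge0.
by rewrite mulrDl (le_trans (ler_normD _ _))// lerD ?le_opnorm.
Qed.

Fact opnormZ (a : R) f : opnorm (a *: f) = `|a| * opnorm f.
Proof.
have le_Z b g : opnorm (b *: g) <= `|b| * opnorm g.
  apply: opnorm_le => [|x]; first by rewrite mulr_ge0 ?opnorm_ge0.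
  by rewrite -mulrA [leLHS]normrZ ler_wpM2l ?le_opnorm.
apply/eqP; rewrite eq_le le_Z/=.
have [->|a0] := eqVneq a 0; first by rewrite normr0 mul0r opnorm_ge0.
rewrite -ler_pdivlMl ?normr_gt0// -normfV.
by rewrite -{1}(scale1r f) -(mulVf a0) -scalerA le_Z.
Qed.

Fact opnorm0_eq0 f : opnorm f = 0 -> f = 0.
Proof.
move=> f0; apply: clinearP => x; apply/eqP; rewrite -normr_le0.
by rewrite (le_trans (le_opnorm f x))// f0 mul0r.
Qed.

HB.instance Definition _ :=
  Lmodule_isNormed.Build R clinear opnormD opnormZ opnorm0_eq0.

Lemma clinear_normE (f : clinear) : `|f| = opnorm f.
Proof. by []. Qed.

Fact mk_clinear_subproof (f : X -> Y) (M : R) :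
  linear f -> (forall x, `|f x| <= M * `|x|) -> f \in clinear_pred.
Proof.
move=> lf fM; apply/asboolP; split=> //.
pose g : {linear X -> Y} := HB.pack f (GRing.isLinear.Build _ _ _ _ _ lf).
apply: (@bounded_linear_continuous _ _ _ g); apply/linear_boundedP.
near=> r => x; apply: le_trans (fM x) _; rewrite ler_wpM2r//.
by near: r; apply: nbhs_pinfty_ge; exact: num_real.
Unshelve. all: by end_near. Qed.

Definition mk_clinear (f : X -> Y) (M : R) (lf : linear f)
  (fM : forall x, `|f x| <= M * `|x|) : clinear :=
  Clinear (mk_clinear_subproof lf fM).

End ContinuousLinear.

Notation "{ 'clinear' X -> Y }" := (clinear X Y)
  (at level 0, X at level 98, Y at level 99, format "{ 'clinear'  X  ->  Y }").

Notation dual X := {clinear X -> (GRing.regular _ : normedModType _)}.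

Section ComposeAdjoint.
Context {R : realType}.
Implicit Types X Y Z : normedModType R.

Fact comp_linear X Y Z (g : {clinear Y -> Z}) (f : {clinear X -> Y}) :
  linear (fun x => g (f x)).
Proof. by move=> a x y; rewrite !linearP. Qed.

Fact comp_bound X Y Z (g : {clinear Y -> Z}) (f : {clinear X -> Y}) x :
  `|g (f x)| <= (`|g| * `|f|) * `|x|.
Proof.
apply: le_trans (le_opnorm g (f x)) _.
by rewrite -mulrA ler_wpM2l ?normr_ge0 ?le_opnorm// -clinear_normE.
Qed.

Definition clinear_comp X Y Z (g : {clinear Y -> Z}) (f : {clinear X -> Y}) :
  {clinear X -> Z} := mk_clinear (comp_linear g f) (comp_bound g f).

Fact transpose_linear X Y (T : {clinear X -> Y}) :
  linear (fun f : dual Y => clinear_comp f T : dual X).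
Proof. by move=> a f g; apply: clinearP. Qed.

Fact transpose_bound X Y (T : {clinear X -> Y}) (f : dual Y) :
  `|clinear_comp f T : dual X| <= `|T| * `|f|.
Proof.
rewrite clinear_normE opnorm_le ?mulr_ge0// => x.
by rewrite (mulrC `|T|) comp_bound.
Qed.

Definition transpose X Y (T : {clinear X -> Y}) : {clinear dual Y -> dual X} :=
  mk_clinear (transpose_linear T) (transpose_bound T).

Definition pairing X (x : X) (xs : dual X) : R := xs x.

Fact eval_linear X (x : X) :
  linear (fun xs : dual X => pairing x xs : R^o).
Proof. by []. Qed.

Fact eval_bound X (x : X) (xs : dual X) :
  `|pairing x xs : R^o| <= `|x| * `|xs|.
Proof. by rewrite mulrC; exact: (le_opnorm xs x). Qed.

Definition eval X (x : X) : dual (dual X) :=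
  mk_clinear (eval_linear x) (@eval_bound X x).

Fact bidual_linear X : linear (@eval X).
Proof. by move=> a x y; apply: clinearP => xs; exact: linearP. Qed.

Fact bidual_bound X (x : X) : `|eval x| <= 1 * `|x|.
Proof.
by rewrite mul1r clinear_normE opnorm_le// => xs; exact: eval_bound.
Qed.

Definition bidual_emb X : {clinear X -> dual (dual X)} :=
  mk_clinear (@bidual_linear X) (@bidual_bound X).

Definition reflexive_space X : Prop := range (bidual_emb X) = setT.

(* The Banach space adjoint of A : X -> X^* is a map X^** -> X^*; it becomes a
   map X -> X^* through the canonical embedding of X in X^**. *)
Definition adjoint X (A : {clinear X -> dual X}) : {clinear X -> dual X} :=
  clinear_comp (transpose A) (bidual_emb X).

Lemma adjointE X (A : {clinear X -> dual X}) (x y : X) :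
  pairing y (adjoint A x) = pairing x (A y).
Proof. by []. Qed.

End ComposeAdjoint.

Section Fitzpatrick.
Context {R : realType} {X : normedModType R}.
Implicit Types (L A : {clinear X -> dual X}) (x : X) (xs : dual X).

Definition monotone A : Prop := forall x, 0 <= pairing x (A x).

Definition symmetric_op A : Prop := adjoint A = A.

Definition sym_part A : {clinear X -> dual X} :=
  2^-1 *: A + 2^-1 *: adjoint A.

Definition skew_part A : {clinear X -> dual X} :=
  2^-1 *: A - 2^-1 *: adjoint A.

Definition quad L x : R := 2^-1 * pairing x (L x).

Definition fenchel_conj (f : X -> \bar R) xs : \bar R :=
  ereal_sup [set ((pairing x xs)%:E - f x)%E | x in [set: X]].

Definition fitzC A (z : X * dual X) : \bar R :=
  ((quad (sym_part A) z.1)%:E +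
   fenchel_conj (fun x => (quad (sym_part A) x)%:E)
     (z.2 - skew_part A z.1)%R)%E.

(* The conjugate of F on X * X^*, with the dual of X * X^* written X^* * X. *)
Definition fenchel_conj2 (F : X * dual X -> \bar R) (w : dual X * X) : \bar R :=
  ereal_sup [set ((pairing z.1 w.1)%:E + (pairing w.2 z.2)%:E - F z)%E
            | z in [set: X * dual X]].

Definition autoconjugate (F : X * dual X -> \bar R) : Prop :=
  forall x xs, fenchel_conj2 F (xs, x) = F (x, xs).

End Fitzpatrick.

(* Main.v *)
Require Import Defs.
From HB Require Import structures.
From mathcomp Require Import all_boot all_order all_algebra.
From mathcomp Require Import boolp classical_sets functions reals ereal.
From mathcomp Require Import topology normedtype.
From mathcomp Require Import lra.

Import Order.TTheory GRing.Theory Num.Theory.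
Import numFieldNormedType.Exports.

Local Open Scope classical_set_scope.
Local Open Scope ring_scope.

Set Implicit Arguments.
Unset Strict Implicit.

(** Write q for the quadratic form of A, so that C_A(x, x* ) = q(x) + q*(x* ).

    C_A satisfies the three conditions because q*(Ay) = q(y)
    ([fenchel_conj_quad_range]), which gives C_A(x, Ay) = q(x) + q(y), and
    because q is its own biconjugate, which gives autoconjugacy.

    Conversely, conjugation reverses the pointwise order, so an autoconjugate F
    lying above the autoconjugate C_A also lies below it:
    F = F* <= C_A* = C_A.  It therefore suffices to prove C_A <= F, and this
    splits according to whether x* lies in the range of A.
    - For x* = Ay, the Fenchel-Young inequality between F(x, Ay) and
      F*(Ax, y) = F(y, Ax) bounds their sum below by 2 q(x) + 2 q(y); as the
      symmetry condition makes the two terms equal, F(x, Ay) >= q(x) + q(y)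
      ([autoconjugate_ge_quad]).
    - For x* outside the range, which is closed, Hahn-Banach in X* and
      reflexivity give z in X that annihilates the range of A without
      annihilating x*.  Since A is symmetric, Az = 0, so F(tz, 0) = F(0, A(tz))
      = F(0, 0) = 0 for all t, and autoconjugacy gives F(x, x* ) >= t <z, x*>
      for all t: F(x, x* ) is infinite ([autoconjugate_pinfty]).

    The separating functional is a linear functional below a sublinear one.
    By Zorn's lemma there is a minimal sublinear functional below a given one,
    and minimality forces linearity ([minimal_sublinear_linear]). *)

(** * Sublinear functionals and separation from a closed subspace *)

Section Sublinear.
Context {R : realType} {V : lmodType R}.
Implicit Types (p q : V -> R) (x y : V).

(** Only one inequality is asked of homogeneity; applied to t and to its
    inverse, it yields equality ([sublinear_homogeneous]). *)
Definition sublinear p : Prop :=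
  (forall x y, p (x + y) <= p x + p y) /\
  (forall t x, 0 < t -> p (t *: x) <= t * p x).

Lemma sublinear0 p : sublinear p -> p 0 = 0.
Proof.
move=> [pD pZ]; have := pD 0 0; have := pZ 2^-1 0.
rewrite scaler0 addr0 => /(_ ltac:(lra)) *; lra.
Qed.

Lemma sublinear_homogeneous p t x :
  sublinear p -> 0 <= t -> p (t *: x) = t * p x.
Proof.
move=> sp; rewrite le_eqVlt => /predU1P[<-|t0].
  by rewrite scale0r mul0r sublinear0.
apply/eqP; rewrite eq_le (proj2 sp)//= -ler_pdivlMl//.
have := proj2 sp t^-1 (t *: x).
by rewrite invr_gt0 t0 scalerA mulVf ?gt_eqF// scale1r => /(_ isT).
Qed.

Lemma sublinear_opp p x : sublinear p -> - p (- x) <= p x.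
Proof.
by move=> sp; have := proj1 sp x (- x); rewrite subrr sublinear0//; lra.
Qed.

(** The common principle behind the three sublinear functionals used below: the
    distance to a subspace, [directional_inf], and the infimum of a chain. *)
Lemma sublinear_inf (S : V -> set R) :
  (forall x, S x !=set0) -> (forall x, has_lbound (S x)) ->
  (forall x y a b, S x a -> S y b -> exists2 c, S (x + y) c & c <= a + b) ->
  (forall t x a, 0 < t -> S x a -> exists2 c, S (t *: x) c & c <= t * a) ->
  sublinear (fun x => inf (S x)).
Proof.
move=> S0 Slb SD SZ; split=> [x y|t x t0].
  rewrite -lerBlDr; apply: lb_le_inf => [//|a Sa]; rewrite lerBlDr -lerBlDl.
  apply: lb_le_inf => // b Sb; rewrite lerBlDl.
  by have [c Sc] := SD _ _ _ _ Sa Sb; apply: le_trans; exact: ge_inf.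
rewrite -ler_pdivrMl//; apply: lb_le_inf => // a Sa; rewrite ler_pdivrMl//.
by have [c Sc] := SZ _ _ _ t0 Sa; apply: le_trans; exact: ge_inf.
Qed.

(** The largest sublinear functional below p whose value at -y is at most
    - p y. *)
Definition directional_inf p y x : R :=
  inf [set p (x + t *: y) - t * p y | t in [set t : R | 0 <= t]].

Lemma directional_inf_lb p y x : sublinear p ->
  has_lbound [set p (x + t *: y) - t * p y | t in [set t : R | 0 <= t]].
Proof.
move=> sp; exists (- p (- x)) => _ [t /= t0 <-].
have := proj1 sp (x + t *: y) (- x).
by rewrite addrC addKr sublinear_homogeneous//; lra.
Qed.

Lemma directional_inf_le p y x t : sublinear p -> 0 <= t ->
  directional_inf p y x <= p (x + t *: y) - t * p y.
Proof.
by move=> sp t0; apply: ge_inf; [exact: directional_inf_lb|exists t].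
Qed.

Lemma directional_inf_sublinear p y : sublinear p ->
  sublinear (directional_inf p y).
Proof.
move=> sp; apply: sublinear_inf.
- by move=> x; exists (p (x + 0 *: y) - 0 * p y); exists 0 => /=.
- by move=> x; exact: directional_inf_lb.
- move=> x x' _ _ [t /= t0 <-] [s /= s0 <-].
  exists (p (x + x' + (t + s) *: y) - (t + s) * p y).
    by exists (t + s) => //=; rewrite addr_ge0.
  by have := proj1 sp (x + t *: y) (x' + s *: y);
    rewrite addrACA -scalerDl; lra.
- move=> a x _ a0 [t /= t0 <-].
  exists (p (a *: x + (a * t) *: y) - (a * t) * p y).
    by exists (a * t) => //=; rewrite mulr_ge0// ltW.
  by rewrite -scalerA -scalerDr (sublinear_homogeneous _ sp (ltW a0)) mulrBr mulrA.
Qed.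

(** By minimality p <= directional_inf p y, and the choice t = 1 in that infimum
    gives p x <= p (x + y) - p y, the missing half of additivity. *)
Lemma minimal_sublinear_linear p : sublinear p ->
  (forall q, sublinear q -> (forall x, q x <= p x) -> forall x, p x <= q x) ->
  linear (p : V -> R^o).
Proof.
move=> sp pmin.
have pD x y : p (x + y) = p x + p y.
  apply/eqP; rewrite eq_le (proj1 sp)/=.
  have le_p z : directional_inf p y z <= p z.
    by have := directional_inf_le y z sp (lexx 0);
      rewrite scale0r addr0 mul0r subr0.
  have := pmin _ (directional_inf_sublinear y sp) le_p x.
  by have := directional_inf_le y x sp ler01; rewrite scale1r; lra.
have pN x : p (- x) = - p x.
  by have := pD x (- x); rewrite subrr sublinear0//; lra.
move=> a x y; rewrite pD; congr (_ + _); have [a0|a0] := leP 0 a.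
  exact: sublinear_homogeneous.
rewrite -[a]opprK scaleNr pN sublinear_homogeneous// ?oppr_ge0 ?ltW//.
by rewrite [RHS]mulNr.
Qed.

(** The pointwise infimum of a nonempty chain of sublinear functionals below p is
    finite because each of them is at least - p (- x) at x, and it is subadditive
    because any two members of the chain are comparable. *)
Lemma hahn_banach p : sublinear p ->
  exists2 f : V -> R, linear (f : V -> R^o) & forall x, f x <= p x.
Proof.
move=> sp; pose T := {q : V -> R | sublinear q /\ forall x, q x <= p x}.
pose r (q q' : T) := `[< forall x, sval q' x <= sval q x >].
have [||C Ctot|m mmax] := @ZL_preorder T (exist _ p (conj sp (fun=> lexx _))) r.
- by move=> q; apply/asboolP.
- move=> q1 q2 q3 /asboolP q12 /asboolP q23; apply/asboolP => x.
  exact: le_trans (q23 x) (q12 x).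
- have [->|/set0P[q0 Cq0]] := eqVneq C set0.
    by exists (exist _ p (conj sp (fun=> lexx _))).
  pose S x := [set sval q x | q in C].
  have Slb x : has_lbound (S x).
    exists (- p (- x)) => _ [[q [sq qp]] _ <-] /=.
    by apply: le_trans (sublinear_opp x sq); rewrite lerN2.
  have S_sub : sublinear (fun x => inf (S x)).
    apply: sublinear_inf => //.
    + by move=> x; exists (sval q0 x); exists q0.
    + move=> x y _ _ [q Cq <-] [q' Cq' <-].
      have [/asboolP qq'|/asboolP qq'] := Ctot _ _ Cq Cq'.
        exists (sval q' (x + y)); first by exists q'.
        apply: le_trans (proj1 (proj1 (svalP q')) x y) _.
        by rewrite lerD2r.
      exists (sval q (x + y)); first by exists q.
      apply: le_trans (proj1 (proj1 (svalP q)) x y) _.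
      by rewrite lerD2l.
    + move=> t x _ t0 [q Cq <-]; exists (sval q (t *: x)); first by exists q.
      exact: (proj2 (proj1 (svalP q))).
  have S_le (q : T) x : C q -> inf (S x) <= sval q x.
    by move=> Cq; apply: ge_inf => //; exists q.
  have S_le_p x : inf (S x) <= p x.
    exact: le_trans (S_le _ x Cq0) (proj2 (svalP q0) x).
  by exists (exist _ (fun x => inf (S x)) (conj S_sub S_le_p)) => q Cq;
    apply/asboolP => x /=; exact: S_le.
- exists (sval m); last exact: (proj2 (svalP m)).
  have [sm mp] := svalP m; apply: minimal_sublinear_linear => // q sq qm x.
  have qp z : q z <= p z by exact: le_trans (qm z) (mp z).
  have /asboolP := mmax (exist _ q (conj sq qp)) (introT (asboolP _) qm).
  exact.
Qed.

End Sublinear.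

Section ClosedSubspace.
Context {R : realType} {V : normedModType R}.
Variable M : set V.
Hypotheses (M0 : M 0) (M_lin : forall (a : R) u v, M u -> M v -> M (a *: u + v)).

Definition dist_to x : R := inf [set `|x - m| | m in M].

Let dist_lb x : has_lbound [set `|x - m| | m in M].
Proof. by exists 0 => _ [m _ <-]. Qed.

Lemma dist_to_sublinear : sublinear dist_to.
Proof.
apply: sublinear_inf => //.
- by move=> x; exists `|x - 0|; exists 0.
- move=> x y _ _ [m Mm <-] [n Mn <-]; exists `|x + y - (m + n)|.
    by exists (m + n) => //; rewrite -[m]scale1r; exact: M_lin.
  by rewrite opprD addrACA ler_normD.
- move=> t x _ t0 [m Mm <-]; exists `|t *: x - t *: m|.
    by exists (t *: m) => //; rewrite -[t *: m]addr0; exact: M_lin.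
  by rewrite -scalerBr normrZ gtr0_norm.
Qed.

Lemma dist_to_le x m : M m -> dist_to x <= `|x - m|.
Proof. by move=> Mm; apply: ge_inf => //; exists m. Qed.

Lemma dist_to_gt0 x : closed M -> ~ M x -> 0 < dist_to x.
Proof.
move=> Mcl Mx; rewrite ltNge; apply/negP => d0; apply: Mx; apply: Mcl.
move=> B /nbhs_ballP[e /= e0 eB].
have [|_ [m Mm <-] dm] := @inf_adherent _ [set `|x - m| | m in M] _ e0.
  by split=> //; exists `|x - 0|; exists 0.
exists m; split=> //; apply: eB; rewrite -ball_normE /=.
by apply: lt_le_trans dm _; rewrite -lerBrDr subrr.
Qed.

(** A linear functional below the distance to M is bounded by the norm and
    vanishes on M, but it could be zero.  Passing first to the directional
    infimum of the distance along x0 forces f (- x0) <= - dist_to x0 < 0. *)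
Lemma closed_subspace_separation x0 : closed M -> ~ M x0 ->
  exists2 f : dual V, (forall m, M m -> f m = 0) & f x0 != 0.
Proof.
move=> Mcl Mx0; have sd := dist_to_sublinear.
have [f f_lin f_le] := hahn_banach (directional_inf_sublinear x0 sd).
have f_le_dist x : f x <= dist_to x.
  apply: le_trans (f_le x) _.
  apply: le_trans (directional_inf_le x0 x sd (lexx 0)) _.
  by rewrite scale0r addr0 mul0r subr0.
pose g : {linear V -> R^o} := HB.pack f (GRing.isLinear.Build _ _ _ _ _ f_lin).
have fN x : f (- x) = - f x := linearN g x.
have f_bound x : `|f x : R^o| <= 1 * `|x|.
  have f_norm y : f y <= `|y|.
    by apply: le_trans (f_le_dist y) _; rewrite -{2}(subr0 y) dist_to_le.
  by rewrite mul1r ler_norml f_norm andbT lerNl -fN -(normrN x) f_norm.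
exists (mk_clinear f_lin f_bound) => /=.
  have f_neg m : M m -> f m <= 0.
    by move=> Mm; apply: le_trans (f_le_dist m) _;
      rewrite -(normr0 V) -(subrr m) dist_to_le.
  move=> m Mm; apply/eqP; rewrite eq_le f_neg//= -oppr_le0 -fN f_neg//.
  by rewrite -[- m]addr0 -scaleN1r; exact: M_lin.
have := le_trans (f_le (- x0)) (directional_inf_le x0 (- x0) sd ler01).
rewrite scale1r addNr (sublinear0 sd) mul1r fN.
by have := dist_to_gt0 Mcl Mx0 => d0 fd; apply/eqP; lra.
Qed.

End ClosedSubspace.

(** * The quadratic form of a symmetric monotone operator *)

Section QuadraticForm.
Context {R : realType} {X : normedModType R}.
Variable A : {clinear X -> dual X}.
Hypotheses (A_monotone : monotone A) (A_symmetric : symmetric_op A).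
Implicit Types (x y : X) (xs ys : dual X).

Let qA : X -> \bar R := fun x => (quad A x)%:E.

Lemma pairing_symmetric x y : pairing y (A x) = pairing x (A y).
Proof. by rewrite -[in LHS]A_symmetric adjointE. Qed.

Lemma quad_ge0 x : 0 <= quad A x.
Proof. by rewrite mulr_ge0. Qed.

(** This is 0 <= q(x - y), expanded using symmetry. *)
Lemma pairing_le_quadD x y : pairing x (A y) <= quad A x + quad A y.
Proof.
have := quad_ge0 (x - y); have := pairing_symmetric x y; rewrite /quad /pairing.
have -> : A (x - y) (x - y) = A x (x - y) - A y (x - y).
  by rewrite [in LHS](linearB A).
by rewrite !linearB /=; lra.
Qed.

Lemma fitzC_symmetric x xs :
  fitzC A (x, xs) = (qA x + fenchel_conj qA xs)%E.
Proof.
have eA : sym_part A = A.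
  rewrite /sym_part A_symmetric -scalerDl -mulr2n -[2^-1]mul1r.
  by rewrite -mulrnAl divff// scale1r.
rewrite /fitzC eA /skew_part A_symmetric subrr /=.
by congr (_ + fenchel_conj _ _)%E; exact: subr0.
Qed.

Lemma fenchel_young x xs :
  ((pairing x xs - quad A x)%:E <= fenchel_conj qA xs)%E.
Proof. by apply: ereal_sup_ubound; exists x. Qed.

Lemma fenchel_conj_quad_range y : fenchel_conj qA (A y) = (quad A y)%:E.
Proof.
apply/eqP; rewrite eq_le; apply/andP; split.
  apply: ge_ereal_sup => _ [x _ <-]; rewrite lee_fin.
  by have := pairing_le_quadD x y; lra.
apply: le_trans (fenchel_young y (A y)); rewrite lee_fin /quad; lra.
Qed.

(** The conjugate of C_A at (xs, x) is at most q(x) + q*(xs) by two Fenchel-Young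
    inequalities. *)
Lemma fitzC_autoconjugate : autoconjugate (fitzC A).
Proof.
move=> x xs; apply/eqP; rewrite eq_le fitzC_symmetric; apply/andP; split.
  apply: ge_ereal_sup => _ [[y ys] _ <-]; rewrite fitzC_symmetric /=.
  have := fenchel_young x ys; have := fenchel_young y xs; rewrite /qA.
  case: (fenchel_conj _ xs) => [a||]; case: (fenchel_conj _ ys) => [b||] //=;
    rewrite ?addry ?leNye ?leey//.
  by rewrite -!EFinD !lee_fin; lra.
(* Taking ys = A x in the supremum recovers q(x), since <x, Ax> - q*(Ax) = q(x). *)
rewrite addeC -leeBrDr//; apply: ge_ereal_sup => _ [y _ <-]; rewrite leeBrDr//.
apply: ereal_sup_ubound; exists (y, A x) => //=.
rewrite fitzC_symmetric fenchel_conj_quad_range /qA /= -!EFinD; congr (_%:E).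
rewrite /quad; lra.
Qed.

(** Separation takes place in the dual of X; reflexivity turns the separating
    functional into a point z, and symmetry of A turns the fact that z
    annihilates the range into A z = 0. *)
Lemma separating_kernel xs : reflexive_space X ->
  closed (range A) -> ~ range A xs -> exists2 z, A z = 0 & pairing z xs != 0.
Proof.
move=> X_refl Acl nxs.
have [||g g0 gxs] := closed_subspace_separation _ _ Acl nxs.
- by exists 0 => //; rewrite linear0.
- by move=> a _ _ [u _ <-] [v _ <-]; exists (a *: u + v) => //; rewrite linearP.
have [z _ zg] : range (bidual_emb X) g by rewrite X_refl.
have gE ys : pairing z ys = g ys by rewrite -zg.
exists z; last by rewrite gE.
apply: clinearP => y; rewrite -[LHS]/(pairing y (A z)) pairing_symmetric gE.
by apply: g0; exists y.
Qed.

(** * Autoconjugate functions with the symmetry property *)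

Variable F : X * dual X -> \bar R.
Hypotheses (F_auto : autoconjugate F)
  (F_sym : forall x y : X, F (x, A y) = F (y, A x)).

(** F(x, Ay) and its conjugate at (Ax, y) coincide, so Fenchel-Young bounds twice
    this common value below by <x, Ax> + <y, Ay>. *)
Lemma autoconjugate_ge_quad x y : (-oo < F (x, A y))%E ->
  ((quad A x + quad A y)%:E <= F (x, A y))%E.
Proof.
have FY : ((pairing x (A x))%:E + (pairing y (A y))%:E - F (x, A y)
    <= F (x, A y))%E.
  rewrite [leRHS]F_sym -[leRHS]F_auto.
  by apply: ereal_sup_ubound; exists (x, A y).
move: FY; case: (F (x, A y)) => [f||//]; last by move=> *; rewrite leey.
by rewrite -!EFinD !lee_fin /quad => *; lra.
Qed.

(** Since F vanishes at every (t *: z, 0), conjugation makes each t <z, xs> a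
    lower bound of F(x, xs). *)
Lemma autoconjugate_pinfty x xs z :
  F (0, 0) = 0%E -> A z = 0 -> pairing z xs != 0 -> F (x, xs) = +oo%E.
Proof.
move=> F0 Az0 zxs; apply/eqyP => r r0; rewrite -F_auto.
pose t := r / pairing z xs.
apply: le_trans (ereal_sup_ubound (imageT _ (t *: z, 0))) => /=.
have -> : F (t *: z, 0) = 0%E.
  by rewrite -(linear0 A) F_sym linearZ/= Az0 scaler0 F0.
rewrite sube0 -EFinD lee_fin {1}/pairing linearZ /= [_ *: (_ : R^o)]divfK//.
by rewrite lerDl; exact: lexx.
Qed.

End QuadraticForm.

Lemma fenchel_conj2_anti {R : realType} {X : normedModType R}
    (F G : X * dual X -> \bar R) (w : dual X * X) :
  (forall z, G z <= F z)%E -> (fenchel_conj2 F w <= fenchel_conj2 G w)%E.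
Proof.
move=> GF; apply: ge_ereal_sup => _ [z _ <-].
by apply: le_trans (ereal_sup_ubound (imageT _ z)); rewrite leeB.
Qed.

Unset Implicit Arguments.
Set Strict Implicit.

Theorem theorem4p4 (R : realType) (X : completeNormedModType R)
    (X_reflexive : reflexive_space X)
    (A : {clinear X -> dual X})
    (A_monotone : monotone A) (A_symmetric : symmetric_op A)
    (A_closed_range : closed (range A))
    (F : X * dual X -> \bar R)
    (F_gtNy : forall z, (-oo < F z)%E) :
  F = fitzC A <->
  [/\ autoconjugate F,
      F (0, 0) = 0%E
    & forall x y : X, F (x, A y) = F (y, A x)].
Proof.
have C_range x y : fitzC A (x, A y) = (quad A x + quad A y)%:E.
  by rewrite fitzC_symmetric// fenchel_conj_quad_range.
split=> [->|[F_auto F0 F_sym]].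
  split; first exact: fitzC_autoconjugate.
    by rewrite -(linear0 A) C_range /quad linear0 /pairing linear0 mulr0 addr0.
  by move=> x y; rewrite !C_range addrC.
have C_le_F z : (fitzC A z <= F z)%E.
  case: z => x xs; have [[y _ <-]|nxs] := pselect (range A xs).
    by rewrite C_range; exact: autoconjugate_ge_quad.
  have [z Az0 zxs] := separating_kernel A_symmetric X_reflexive A_closed_range nxs.
  by rewrite (autoconjugate_pinfty F_auto F_sym x F0 Az0 zxs) leey.
apply/funext => -[x xs]; apply/eqP; rewrite eq_le C_le_F andbT.
rewrite -F_auto -(fitzC_autoconjugate A_monotone A_symmetric).
exact: fenchel_conj2_anti.
Qed.
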